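(* Let $n\ge 1$, let $\beta>1$ be a real number and let $\log$ denote the logarithm in base $\beta$. Let $S\subseteq [n]^2$ be such that $\mathcal{M}_S\not\subseteq\Sigma$ (that is, $\mathcal{M}_S$ contains at least one non-singular matrix). Then $$\mathbf{E}\big(\log_+(\mathbf{c}(A,b))\big)\leq \log n+2\log|S|+\log 10+\frac{1}{\ln \beta},$$ where $\mathbf{E}$ denotes expectation over $(A,b)\in\mathcal{R}_S\times N(0,\mathrm{Id}_n)$, i.e. $A$ is drawn from $\mathcal{R}_S$ and, independently, $b\in\mathbb{R}^n$ is a standard Gaussian vector.
   Context: Notation: $[n]=\{1,\dots,n\}$; $\mathcal{M}$ is the set of $n\times n$ real matrices, $\Sigma\subset\mathcal{M}$ the subset of singular matrices. For $S\subseteq[n]^2$, $\mathcal{M}_S=\{A\in\mathcal{M}\mid a_{ij}=0 \text{ whenever } (i,j)\notin S\}$. $\mathcal{R}_S$ is the space of random $n\times n$ matrices obtained by setting $a_{ij}=0$ if $(i,j)\notin S$ and drawing all other entries independently from the standard Gaussian $N(0,1)$. $\log_+(x)=\log x$ if $x\ge 1$ and $\log_+(x)=0$ otherwise (with $\log_+(\infty)=\infty$). For $(A,b)\in\mathcal{M}\times\mathbb{R}^n$ and $\delta>0$, $\mathcal{B}((A,b),\delta)$ is the set of $(A',b')\in\mathcal{M}\times\mathbb{R}^n$ with $|a'_{ij}-a_{ij}|\le\delta|a_{ij}|$ and $|b'_i-b_i|\le\delta|b_i|$ for all $i,j\in[n]$ (so zero entries are not perturbed). Componentwise condition number for linear equation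 solving: for $A\in\mathcal{M}\setminus\Sigma$ and $b\in\mathbb{R}^n$ write $x=A^{-1}b$, and $x'=A'^{-1}b'$ for a perturbed pair $(A',b')$ (for $\delta$ small all such $A'$ are non-singular). For $k\in[n]$ with $x_k\ne0$ let $$\mathbf{c}_k(A,b)=\lim_{\delta\to0}\ \sup_{(A',b')\in\mathcal{B}((A,b),\delta)}\frac{|x'_k-x_k|}{\delta|x_k|};$$ for $k$ with $x_k=0$ let $\mathbf{c}_k(A,b)=0$ if $\lim_{\delta\to0}\sup_{(A',b')\in\mathcal{B}((A,b),\delta)}\frac{|x'_k-x_k|}{\delta}=0$, and $\mathbf{c}_k(A,b)=\infty$ otherwise. Then $\mathbf{c}(A,b)=\max_{k\in[n]}\mathbf{c}_k(A,b)\in[0,\infty]$. The value of $\mathbf{c}(A,b)$ for singular $A$, which form a null set under the hypothesis of the claim, is immaterial. *)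

(* Defs.v *)
From mathcomp Require Import all_boot all_order all_algebra.
From mathcomp Require Import all_classical all_reals all_analysis.

Set Implicit Arguments.
Unset Strict Implicit.
Unset Printing Implicit Defensive.

Import Order.TTheory GRing.Theory Num.Theory.
Import numFieldNormedType.Exports.

Local Open Scope classical_set_scope.
Local Open Scope ring_scope.

Definition log_base (R : realType) (beta x : R) : R := ln x / ln beta.

Definition log_plus (R : realType) (beta : R) (x : \bar R) : \bar R :=
  match x with
  | r%:E => if 1 <= r then (log_base beta r)%:E else 0%E
  | +oo%E => +oo%E
  | -oo%E => 0%E
  end.

Definition singular_mx (R : realType) (n : nat) : set 'M[R]_n :=
  [set A | A \notin unitmx].

Definition pattern_mx (R : realType) (n : nat) (S : {set 'I_n * 'I_n}) :
    set 'M[R]_n :=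
  [set A | forall i j, (i, j) \notin S -> A i j = 0].

Definition componentwise_ball (R : realType) (n : nat)
    (A : 'M[R]_n) (b : 'cV[R]_n) (delta : R) : set ('M[R]_n * 'cV[R]_n) :=
  [set Ab' : 'M[R]_n * 'cV[R]_n |
    (forall i j, `|Ab'.1 i j - A i j| <= delta * `|A i j|) /\
    (forall i, `|Ab'.2 i 0 - b i 0| <= delta * `|b i 0|)].

(* [invmx] returns its argument on singular matrices; for non-singular [A] this
   affects the perturbed systems in [componentwise_ball A b delta] only when
   [delta] is not small, hence not the limits below. *)
Definition solution (R : realType) (n : nat) (A : 'M[R]_n) (b : 'cV[R]_n) :
    'cV[R]_n :=
  invmx A *m b.

Definition sup_relative_error (R : realType) (n : nat)
    (A : 'M[R]_n) (b : 'cV[R]_n) (k : 'I_n) (delta : R) : \bar R :=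
  ereal_sup [set (`|solution Ab'.1 Ab'.2 k 0 - solution A b k 0|
                  / (delta * `|solution A b k 0|))%:E
            | Ab' in componentwise_ball A b delta].

Definition sup_absolute_error (R : realType) (n : nat)
    (A : 'M[R]_n) (b : 'cV[R]_n) (k : 'I_n) (delta : R) : \bar R :=
  ereal_sup [set (`|solution Ab'.1 Ab'.2 k 0 - solution A b k 0| / delta)%:E
            | Ab' in componentwise_ball A b delta].

Definition cond_coord (R : realType) (n : nat)
    (A : 'M[R]_n) (b : 'cV[R]_n) (k : 'I_n) : \bar R :=
  if solution A b k 0 != 0 then
    lim (sup_relative_error A b k delta @[delta --> 0^'+])
  else if `[< sup_absolute_error A b k delta @[delta --> 0^'+] --> 0%E >] then
    0%E
  else +oo%E.

(* Singular matrices are ill-posed and get the value [+oo]. *)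
Definition cond_linear (R : realType) (n : nat)
    (A : 'M[R]_n) (b : 'cV[R]_n) : \bar R :=
  if A \in unitmx then \big[maxe/0%E]_(k < n) cond_coord A b k else +oo%E.

Definition mutually_independent (d : measure_display) (T : measurableType d)
    (R : realType) (P : probability T R) (I : finType) (D : {set I})
    (X : I -> {RV P >-> R}) : Prop :=
  forall (J : {set I}) (B : I -> set R),
    J \subset D -> (forall i, measurable (B i)) ->
    P (\bigcap_(i in [set` J]) (X i @^-1` B i)) =
    (\prod_(i in J) P (X i @^-1` B i))%E.

Definition standard_gaussian (d : measure_display) (T : measurableType d)
    (R : realType) (P : probability T R) (X : {RV P >-> R}) : Prop :=
  forall B : set R, measurable B -> distribution P X B = normal_prob 0 1 B.

(* The entries of a random system indexed by a single type: [inl (i, j)] is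
   the entry (i, j) of the matrix and [inr i] the entry i of the vector. *)
Definition entries (V : Type) (n : nat) (a : 'I_n -> 'I_n -> V)
    (b : 'I_n -> V) (u : 'I_n * 'I_n + 'I_n) : V :=
  match u with inl ij => a ij.1 ij.2 | inr i => b i end.

Definition free_entries (n : nat) (S : {set 'I_n * 'I_n}) :
    {set 'I_n * 'I_n + 'I_n} :=
  [set u | match u with inl ij => ij \in S | inr _ => true end].

(* [(a, b)] has the law of R_S x N(0, Id_n). *)
Definition gaussian_system (d : measure_display) (T : measurableType d)
    (R : realType) (P : probability T R) (n : nat) (S : {set 'I_n * 'I_n})
    (a : 'I_n -> 'I_n -> {RV P >-> R}) (b : 'I_n -> {RV P >-> R}) : Prop :=
  [/\ forall i j, (i, j) \notin S -> forall w, a i j w = 0,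
      forall u, u \in free_entries S -> standard_gaussian (entries a b u)
    & mutually_independent (free_entries S) (entries a b)].

(* Main.v *)
(** Let f = det A and let g_k be the determinant of A with its k-th column
    replaced by b, so that x_k = g_k / f.  Both are affine in each entry u of
    (A, b), and to first order the k-th condition number is at most the sum over
    the at most 3|S| relevant entries of |u f_u / f| and |u g_u / g|, where f_u,
    g_u are the partial derivatives.  Conditionally on the other entries,
    f = u f_u + f_0 with u a standard Gaussian, and
    P(|u| >= t |u + z|) <= 2 M / (t - 1) uniformly in z, where
    M = max_v v phi(v) <= 4/13 for the Gaussian density phi.  A union bound gives
    P(c(A, b) >= 10 n |S|^2 (3/2)^j) <= 72/91 (2/3)^j, and summing over j >= 0
    bounds the expectation of the logarithm. *)

From HB Require Import structures.
Require Import Defs.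
From mathcomp Require Import all_boot all_order all_algebra.
From mathcomp Require Import all_classical all_reals all_analysis.
From mathcomp Require Import measurable_realfun ring lra.

Set Implicit Arguments.
Unset Strict Implicit.
Unset Printing Implicit Defensive.

Import Order.TTheory GRing.Theory Num.Theory.
Import numFieldNormedType.Exports.

Local Open Scope classical_set_scope.
Local Open Scope ring_scope.

(** * Componentwise perturbation of linear systems *)

(** The k-th entry of |A^-1| (|b| + |A| |x|), the first-order bound for |x'_k - x_k| / delta. *)
Definition amplification (R : realType) (n : nat) (A : 'M[R]_n) (b x : 'cV[R]_n)
    (k : 'I_n) : R :=
  \sum_i `|invmx A k i| * (`|b i 0| + \sum_j `|A i j| * `|x j 0|).

(** From x' - x = A^-1 ((b' - b) - (A' - A) x') and |x'| <= |x| + |x' - x|. The unknown error stays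
    on the right, with a factor delta, to be absorbed later. *)
Lemma perturbation_le (R : realType) n (A A' : 'M[R]_n) (b b' x x' : 'cV[R]_n)
    (delta : R) (k : 'I_n) :
  A \in unitmx -> A *m x = b -> A' *m x' = b' ->
  componentwise_ball A b delta (A', b') ->
  `|x' k 0 - x k 0| <= delta * (amplification A b x k +
     (\sum_i `|invmx A k i| * \sum_j `|A i j|) * \sum_j `|x' j 0 - x j 0|).
Proof.
move=> uA Ax A'x' [/= dA db].
have E : x' - x = invmx A *m ((b' - b) - (A' - A) *m x').
  rewrite mulmxBl A'x' opprB [X in _ *m X]addrC addrA subrK -Ax.
  by rewrite -mulmxBr mulmxA mulVmx // mul1mx.
have -> : x' k 0 - x k 0 = (x' - x) k 0 by rewrite !mxE.
rewrite {}E mxE.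
apply: (le_trans (ler_norm_sum _ _ _)).
rewrite /amplification mulr_suml -big_split /= mulr_sumr; apply: ler_sum => i _.
rewrite normrM -mulrA -mulrDr mulrCA ler_wpM2l ?normr_ge0//.
rewrite !mxE.
apply: (le_trans (ler_normB _ _)).
rewrite -addrA mulrDr; apply: lerD => //.
apply: (le_trans (ler_norm_sum _ _ _)).
rewrite mulr_suml -big_split /= mulr_sumr; apply: ler_sum => j _.
rewrite normrM !mxE -mulrDr mulrA; apply: ler_pM => //.
have le1 : `|x' j 0 - x j 0| <= \sum_l `|x' l 0 - x l 0|.
  by rewrite (bigD1 j) //= lerDl sumr_ge0.
apply: le_trans (_ : `|x j 0| + `|x' j 0 - x j 0| <= _).
  by apply: le_trans (ler_normD _ _); rewrite addrC subrK.
by rewrite lerD2l.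
Qed.

Lemma perturbation_sum_le (R : realType) n (A A' : 'M[R]_n) (b b' x x' : 'cV[R]_n)
    (delta : R) :
  A \in unitmx -> A *m x = b -> A' *m x' = b' ->
  componentwise_ball A b delta (A', b') ->
  2 * delta * \sum_k (\sum_i `|invmx A k i| * \sum_j `|A i j|) <= 1 ->
  \sum_j `|x' j 0 - x j 0| <= 2 * delta * \sum_k amplification A b x k.
Proof.
move=> uA Ax A'x' AB small.
(* Summing over k gives s <= delta (H + c s) for the total error s; since delta c <= 1/2, the term
   in s is absorbed on the left. *)
have absorb (s c H : R) : 0 <= s -> 2 * delta * c <= 1 ->
    s <= delta * (H + c * s) -> s <= 2 * delta * H by nra.
apply: absorb (sumr_ge0 _ _) small _ => //.
rewrite mulr_suml -big_split mulr_sumr /=; apply: ler_sum => k _.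
exact: perturbation_le AB.
Qed.

(** A kernel vector of [A'] solves a perturbed system with zero right-hand side, whose unperturbed
    solution is 0; the error bound then forces it to vanish. *)
Lemma perturbation_unitmx (R : realType) n (A A' : 'M[R]_n) (delta : R) :
  A \in unitmx -> (forall i j, `|A' i j - A i j| <= delta * `|A i j|) ->
  2 * delta * \sum_k (\sum_i `|invmx A k i| * \sum_j `|A i j|) <= 1 ->
  A' \in unitmx.
Proof.
move=> uA dA small.
rewrite unitmxE unitfE -det_tr; apply/det0P => -[v v0 vA].
have A'v : A' *m v^T = 0 by apply: trmx_inj; rewrite trmx_mul trmxK trmx0.
have ball : componentwise_ball A (0 : 'cV_n) delta (A', 0).
  by split=> //= i; rewrite !mxE subrr normr0 mulr0.
have := @perturbation_sum_le R n A A' 0 0 0 v^T delta uA (mulmx0 _ _) A'v ball small.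
rewrite [X in _ * X]big1 ?mulr0; last first.
  move=> k _; rewrite /amplification big1 // => i _.
  by rewrite mxE normr0 add0r big1 ?mulr0 // => j _; rewrite mxE normr0 mulr0.
move=> s0; case/negP: v0; apply/eqP/rowP => j; rewrite mxE.
apply/eqP; rewrite -normr_eq0 eq_le normr_ge0 andbT; apply: le_trans s0.
rewrite (bigD1 j) //= !mxE subr0 lerDl sumr_ge0 //.
Qed.

(** For small delta the worst error is at most delta times the amplification plus a term quadratic
    in delta, which disappears in the limit. *)
Lemma cond_coord_le (R : realType) n (A : 'M[R]_n) (b : 'cV[R]_n) (k : 'I_n) :
  A \in unitmx -> solution A b k 0 != 0 ->
  (cond_coord A b k <= (amplification A b (solution A b) k / `|solution A b k 0|)%:E)%E.
Proof.
move=> uA xk0; rewrite /cond_coord xk0.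
set x := solution A b.
have Ax : A *m x = b by rewrite mulmxA mulmxV // mul1mx.
set c := \sum_k (\sum_i `|invmx A k i| * \sum_j `|A i j|).
have c0 : 0 <= c by apply: sumr_ge0 => i _; apply: sumr_ge0 => j _; rewrite mulr_ge0 // sumr_ge0.
set H := \sum_k amplification A b x k.
have amp0 l : 0 <= amplification A b x l.
  apply: sumr_ge0 => i _; rewrite mulr_ge0 // addr_ge0 //; apply: sumr_ge0 => j _.
  by rewrite mulr_ge0.
have H0 : 0 <= H by apply: sumr_ge0.
have bnd delta : 0 < delta -> 2 * delta * c <= 1 ->
  (sup_relative_error A b k delta <=
    ((amplification A b x k + delta * (2 * c * H)) / `|x k 0|)%:E)%E.
  move=> d0 small; apply: ge_ereal_sup => _ [[A' b'] AB <-] /=.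
  have uA' : A' \in unitmx by case: (AB) => dA _; apply: perturbation_unitmx dA small.
  rewrite lee_fin -/x; set x' := solution A' b'.
  have A'x' : A' *m x' = b' by rewrite mulmxA mulmxV // mul1mx.
  rewrite invfM mulrA ler_pM2r ?invr_gt0 ?normr_gt0 //.
  rewrite ler_pdivrMr // mulrC.
  apply: le_trans (perturbation_le _ uA Ax A'x' AB) _.
  rewrite ler_pM2l // lerD2l.
  have -> : delta * (2 * c * H) = c * (2 * delta * H) by ring.
  apply: ler_pM => //.
  - by apply: sumr_ge0 => i _; rewrite mulr_ge0 // sumr_ge0.
  - exact: sumr_ge0.
  - rewrite /c [leRHS](bigD1 k) //= lerDl sumr_ge0 // => l _; apply: sumr_ge0 => i _.
    by apply: mulr_ge0 => //; apply: sumr_ge0.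
  - exact: perturbation_sum_le AB small.
(* A limit that does not exist is the junk value [point], that is [0]. *)
have [cvgE|ncvg] := pselect (cvg (sup_relative_error A b k delta @[delta --> 0^'+])); last first.
  by rewrite dvgP // lee_fin divr_ge0.
apply/lee_addgt0Pr => e e0.
apply: lime_le => //.
set eta := e * `|x k 0|.
have eta0 : 0 < eta by rewrite mulr_gt0 // normr_gt0.
near=> delta.
have d0 : 0 < delta by near: delta; exact: nbhs_right_gt.
(* The first bound gives 2 delta c <= 1, the second keeps the remainder below e |x_k|; the summand 1
   keeps both denominators positive. *)
have d1 : delta < (2 * c + 1)^-1.
  near: delta; apply: nbhs_right_lt; rewrite invr_gt0; lra.
have d2 : delta < eta / (2 * c * H + 1).
  near: delta; apply: nbhs_right_lt; rewrite divr_gt0 //.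
  by rewrite ltr_wpDl // !mulr_ge0.
apply: le_trans (bnd delta d0 _) _.
  move: d1; rewrite -[(_)^-1]mul1r ltr_pdivlMr; nra.
rewrite -EFinD lee_fin mulrDl lerD2l ler_pdivrMr ?normr_gt0 // -/eta.
move: d2; rewrite ltr_pdivlMr; last by rewrite ltr_wpDl // !mulr_ge0.
by rewrite mulrDr mulr1 => ?; lra.
Unshelve. all: end_near.
Qed.
(** * Multiaffine functions and Cramer's rule *)

Definition update (R : Type) (U : eqType) (x : U -> R) (u : U) (s : R) : U -> R :=
  fun v => if v == u then s else x v.

(** For a function affine in the entry [u] this is the partial derivative in that entry. *)
Definition slope (R : realType) (U : eqType) (f : (U -> R) -> R) (x : U -> R)
    (u : U) : R :=
  f (update x u 1) - f (update x u 0).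

Definition multiaffine (R : realType) (U : eqType) (f : (U -> R) -> R) : Prop :=
  forall x u s, f (update x u s) = s * slope f x u + f (update x u 0).

(** The map [e] places the variables in the matrix, so that det A and the Cramer determinants are
    instances of one function. *)
Definition det_at (R : realType) (U : eqType) n (e : 'I_n -> 'I_n -> U)
    (x : U -> R) : R :=
  \det (\matrix_(i, j) x (e i j)).

(** Places the variables of A with column k replaced by b. *)
Definition cramer_index n (k i j : 'I_n) : 'I_n * 'I_n + 'I_n :=
  if j == k then inr i else inl (i, j).

Lemma update_id (R : Type) (U : eqType) (x : U -> R) (u : U) : update x u (x u) = x.
Proof. by apply/funext => v; rewrite /update; case: eqP => [->|]. Qed.

Lemma update_update (R : Type) (U : eqType) (x : U -> R) (u : U) s t :
  update (update x u s) u t = update x u t.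
Proof. by apply/funext => v; rewrite /update; case: eqP. Qed.

Lemma multiaffineE (R : realType) (U : eqType) (f : (U -> R) -> R) x u :
  multiaffine f -> f x = x u * slope f x u + f (update x u 0).
Proof. by move=> /(_ x u (x u)); rewrite update_id. Qed.

(** Injectivity of [e] lets a variable occur in at most one position, and the determinant is linear
    in the row containing it. *)
Lemma multiaffine_det_at (R : realType) (U : eqType) n (e : 'I_n -> 'I_n -> U) :
  (forall i j i' j', e i j = e i' j' -> (i, j) = (i', j')) ->
  multiaffine (@det_at R U n e).
Proof.
move=> inj_e x u s; rewrite /slope /det_at.
have [[[i j] /= eij]|none] := pselect (exists p, e p.1 p.2 = u); last first.
  have same t : \matrix_(i, j) update x u t (e i j) = \matrix_(i, j) x (e i j).
    apply/matrixP => i j; rewrite !mxE /update; case: eqP => // eu.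
    by case: none; exists (i, j).
  by rewrite !same subrr mulr0 add0r.
(* Brings the right-hand side to the form s det_1 + (1 - s) det_0 of linearity in one row. *)
rewrite mulrBr -addrA -[X in _ + (_ + X)]mul1r -mulNr -mulrDl [- s + 1]addrC.
have other t t' : row' i (\matrix_(i, j) update x u t (e i j)) =
                  row' i (\matrix_(i, j) update x u t' (e i j)).
  apply/matrixP => i' j'; rewrite !mxE /update; case: eqP => // eu.
  by have := neq_lift i i'; have [<- _] := inj_e _ _ _ _ (etrans eij (esym eu)); rewrite eqxx.
apply: (determinant_multilinear (i0 := i)) => //.
apply/matrixP => i' j'; rewrite !mxE /update; case: eqP => _; last by ring.
by rewrite mulr1 mulr0 addr0.
Qed.

Lemma cramer_index_inj n (k : 'I_n) i j i' j' :
  cramer_index k i j = cramer_index k i' j' -> (i, j) = (i', j').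
Proof.
rewrite /cramer_index; case: (eqVneq j k) => [->|_];
  case: (eqVneq j' k) => [->|_] [] *; subst=> //.
Qed.

Section system.
Variables (R : realType) (n : nat).
Local Notation U := ('I_n * 'I_n + 'I_n)%type.
Implicit Types (x : U -> R) (i j k : 'I_n).

Definition sys_mx x : 'M[R]_n := \matrix_(i, j) x (inl (i, j)).
Definition sys_col x : 'cV[R]_n := \col_i x (inr i).

Definition sys_det x : R := det_at (fun i j => inl (i, j)) x.
Definition cramer_det k x : R := det_at (cramer_index k) x.

Lemma multiaffine_sys_det : multiaffine sys_det.
Proof. by apply: multiaffine_det_at => i j i' j' [-> ->]. Qed.

Lemma multiaffine_cramer_det k : multiaffine (cramer_det k).
Proof. exact/multiaffine_det_at/cramer_index_inj. Qed.

(** Expansion along column k, whose cofactors are those of A. *)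
Lemma cramer_detE k x : cramer_det k x = (\adj (sys_mx x) *m sys_col x) k 0.
Proof.
rewrite /cramer_det /det_at (expand_det_col _ k) !mxE; apply: eq_bigr => i _.
rewrite !mxE /cramer_index eqxx mulrC; congr (_ * _).
rewrite /cofactor; congr (_ * \det _); apply/matrixP => i' j'; rewrite !mxE.
by rewrite eq_sym (negbTE (neq_lift _ _)).
Qed.

Lemma cofactor_update x i j s l :
  cofactor (sys_mx (update x (inl (i, j)) s)) i l = cofactor (sys_mx x) i l.
Proof.
rewrite /cofactor; congr (_ * \det _); apply/matrixP => i' j'; rewrite !mxE /update.
by case: eqP => // -[E]; have := neq_lift i i'; rewrite E eqxx.
Qed.

Lemma slope_sys_det x i j : slope sys_det x (inl (i, j)) = cofactor (sys_mx x) i j.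
Proof.
rewrite /slope /sys_det /det_at !(expand_det_row _ i) -sumrB (bigD1 j) //= big1 ?addr0.
  rewrite !cofactor_update !mxE /update eqxx; ring.
move=> l lj; rewrite !cofactor_update !mxE /update.
by case: eqP => [[/eqP]|_]; rewrite ?(negbTE lj) // subrr.
Qed.

Lemma slope_cramer_det_col x k i : slope (cramer_det k) x (inr i) = cofactor (sys_mx x) i k.
Proof.
rewrite /slope !cramer_detE.
have same s : sys_mx (update x (inr i) s) = sys_mx x by apply/matrixP => i' j'; rewrite !mxE.
rewrite !same !mxE -sumrB (bigD1 i) //= big1 ?addr0.
  by rewrite !mxE /update eqxx; ring.
move=> l li; rewrite !mxE /update.
by case: eqP => [[/eqP]|_]; rewrite ?(negbTE li) // subrr.
Qed.

Lemma cramer_rule x k : sys_det x != 0 ->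
  cramer_det k x = sys_det x * solution (sys_mx x) (sys_col x) k 0.
Proof.
move=> d0; rewrite cramer_detE /solution /invmx unitmxE unitfE d0.
by rewrite -scalemxAl [X in _ = _ * X]mxE mulrA mulfV // mul1r.
Qed.

(* Adding 1 to the entry (i, j) of A turns A x = b into A' x = b + x_j e_i;
   compare the two Cramer rules for the common solution x. *)
Lemma slope_cramer_det_mx x k i j : sys_det x != 0 ->
  let y := solution (sys_mx x) (sys_col x) in
  slope (cramer_det k) x (inl (i, j)) =
    y k 0 * cofactor (sys_mx x) i j - y j 0 * cofactor (sys_mx x) i k.
Proof.
move=> d0 y.
set x' := update x (inl (i, j)) (x (inl (i, j)) + 1).
have Ay : sys_mx x *m y = sys_col x by rewrite mulmxA mulmxV ?mul1mx // unitmxE unitfE.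
have col' : sys_col x' = sys_col x by apply/matrixP => l m; rewrite !mxE.
have A'y : sys_mx x' *m y = sys_col x + y j 0 *: delta_mx i 0.
  have -> : sys_mx x' = sys_mx x + delta_mx i j.
    apply/matrixP => l m; rewrite !mxE /x' /update.
    have [[-> ->]|ne] := eqVneq (l, m) (i, j); first by rewrite !eqxx.
    case: eqP => [[El Em]|_]; first by rewrite El Em eqxx in ne.
    by move: ne; rewrite xpair_eqE => /negbTE ->; rewrite addr0.
  rewrite mulmxDl Ay; congr (_ + _); apply/matrixP => l m.
  rewrite !mxE (bigD1 j) //= big1 ?addr0 => [|p pj]; rewrite !mxE.
    by rewrite eqxx andbT ord1 eqxx andbT mulrC.
  by rewrite (negbTE pj) andbF mul0r.
(* Coordinate k of adj(A') A' y is det(A') y_k on one side and, by A' y = b + y_j e_i, a Cramer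
   determinant plus y_j times a cofactor on the other. *)
have := congr1 (fun v : 'cV_n => v k 0) (mulmxA (\adj (sys_mx x')) (sys_mx x') y).
rewrite mul_adj_mx A'y mulmxDr mul_scalar_mx -scalemxAr.
rewrite [LHS]mxE -col' -cramer_detE [X in _ + X]mxE [RHS]mxE.
have -> : (\adj (sys_mx x') *m delta_mx i (0 : 'I_1)) k 0 = cofactor (sys_mx x) i k.
  rewrite mxE (bigD1 i) //= big1 ?addr0 => [|p pi]; rewrite !mxE.
    by rewrite !eqxx mulr1 cofactor_update.
  by rewrite (negbTE pi) mulr0.
have -> : cramer_det k x' = slope (cramer_det k) x (inl (i, j)) + cramer_det k x.
  rewrite multiaffine_cramer_det mulrDl mul1r.
  rewrite (multiaffineE x (inl (i, j)) (multiaffine_cramer_det k)).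
  ring.
have -> : \det (sys_mx x') = cofactor (sys_mx x) i j + sys_det x.
  rewrite -[LHS]/(sys_det x') multiaffine_sys_det slope_sys_det mulrDl mul1r.
  rewrite (multiaffineE x (inl (i, j)) multiaffine_sys_det) slope_sys_det; ring.
rewrite cramer_rule // -/y => H.
apply/(addIr (sys_det x * y k 0)); rewrite -[LHS](addrK (y j 0 * cofactor (sys_mx x) i k)) H.
ring.
Qed.

End system.

(** * Sensitivities bound the condition number *)

(** After multiplication by |det A| the entries of A^-1 become cofactors. Each of the n terms in b
    is a sensitivity of g_k, at most t |g_k|; each of the |S| terms in A is a difference of two
    sensitivities, at most 2 t |g_k|. *)
Lemma amplification_sys_le (R : realType) n (S : {set 'I_n * 'I_n})
    (x : 'I_n * 'I_n + 'I_n -> R) (t : R) (k : 'I_n) :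
  (forall i j, (i, j) \notin S -> x (inl (i, j)) = 0) ->
  sys_det x != 0 ->
  (forall p, p \in S ->
     `|x (inl p) * slope (@sys_det R n) x (inl p)| <= t * `|sys_det x|) ->
  (forall u, u \in free_entries S ->
     `|x u * slope (cramer_det k) x u| <= t * `|cramer_det k x|) ->
  amplification (sys_mx x) (sys_col x) (solution (sys_mx x) (sys_col x)) k <=
  (2 * #|S|%:R + n%:R) * t * `|solution (sys_mx x) (sys_col x) k 0|.
Proof.
move=> xS f0 senf seng.
have fpos : 0 < `|sys_det x| by rewrite normr_gt0.
rewrite -(ler_pM2l fpos) /amplification mulr_sumr.
set y := solution _ _.
have gE : `|cramer_det k x| = `|sys_det x| * `|y k 0| by rewrite cramer_rule // normrM.
rewrite [leRHS](_ : _ = n%:R * (t * `|cramer_det k x|) +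
    #|S|%:R * (2 * t * `|cramer_det k x|)); last first.
  by rewrite gE; ring.
rewrite (_ : \sum_i _ = \sum_i `|x (inr i) * slope (cramer_det k) x (inr i)| +
    \sum_i \sum_j `|x (inl (i, j)) * (y j 0 * cofactor (sys_mx x) i k)|); last first.
  rewrite -big_split; apply: eq_bigr => i _ /=.
  have inv : `|sys_det x| * `|invmx (sys_mx x) k i| = `|cofactor (sys_mx x) i k|.
    by rewrite /invmx unitmxE unitfE f0 !mxE normrM normfV mulrA mulfV ?mul1r // gt_eqF.
  rewrite mulrA inv mulrDr; congr (_ + _).
    by rewrite slope_cramer_det_col [sys_col x _ _]mxE [RHS]normrM mulrC.
  rewrite mulr_sumr; apply: eq_bigr => j _.
  by rewrite [sys_mx x i j]mxE [RHS]normrM [in RHS]normrM; ring.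
apply: lerD.
  rewrite -[n in n%:R]card_ord -sumr_const; rewrite mulr_suml.
  by apply: ler_sum => i _; rewrite mul1r; apply: seng; rewrite inE.
rewrite pair_bigA /= (bigID (mem S)) /= [X in _ + X]big1 ?addr0; last first.
  by move=> [i j] /= /xS ->; rewrite mul0r normr0.
rewrite -sumr_const mulr_suml; apply: ler_sum => -[i j] /= ijS; rewrite mul1r.
(* Solves [slope_cramer_det_mx] for the cofactor term: the entry (i, j) acts on x_k through det A
   and through g_k. *)
have -> : y j 0 * cofactor (sys_mx x) i k =
    y k 0 * slope (@sys_det R n) x (inl (i, j)) - slope (cramer_det k) x (inl (i, j)).
  by rewrite slope_cramer_det_mx // slope_sys_det -/y; ring.
rewrite mulrBr; apply: (le_trans (ler_normB _ _)).
rewrite (_ : 2 * t * _ = t * `|cramer_det k x| + t * `|cramer_det k x|); last by ring.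
apply: lerD; last by apply: seng; rewrite inE.
rewrite mulrCA normrM gE mulrA [leRHS]mulrC ler_wpM2l //.
exact: senf.
Qed.

Lemma cond_linear_le (R : realType) n (S : {set 'I_n * 'I_n})
    (x : 'I_n * 'I_n + 'I_n -> R) (t : R) :
  (forall i j, (i, j) \notin S -> x (inl (i, j)) = 0) ->
  sys_det x != 0 -> (forall k, cramer_det k x != 0) -> 0 <= t ->
  (forall p, p \in S ->
     `|x (inl p) * slope (@sys_det R n) x (inl p)| <= t * `|sys_det x|) ->
  (forall k u, u \in free_entries S ->
     `|x u * slope (cramer_det k) x u| <= t * `|cramer_det k x|) ->
  (cond_linear (sys_mx x) (sys_col x) <= ((2 * #|S|%:R + n%:R) * t)%:E)%E.
Proof.
move=> xS f0 g0 t0 senf seng.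
have uA : sys_mx x \in unitmx by rewrite unitmxE unitfE.
rewrite /cond_linear uA.
have K0 : 0 <= (2 * #|S|%:R + n%:R) * t by rewrite mulr_ge0 // addr_ge0.
elim/big_ind: _ => [|c c' cK c'K|k _]; first by rewrite lee_fin.
  by rewrite ge_max cK c'K.
(* Nonzero Cramer determinants exclude x_k = 0, hence the branch of [cond_coord] with absolute
   errors. *)
have yk0 : solution (sys_mx x) (sys_col x) k 0 != 0.
  by have := g0 k; rewrite cramer_rule // mulf_eq0 negb_or => /andP[].
apply: le_trans (cond_coord_le uA yk0) _.
rewrite lee_fin ler_pdivrMr ?normr_gt0 //.
by apply: (@amplification_sys_le _ _ S) => // u; apply: seng.
Qed.

(** * Independent families *)

(** Independence on rectangles makes the joint law a product measure, so the probability of E is the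
    integral of its sections against the law of Y. *)
Lemma probability_section_le d d' (T : measurableType d) (T' : measurableType d')
    (R : realType) (P : probability T R) (X : {RV P >-> R}) (Y : {mfun T >-> T'})
    (E : set (T' * R)) (p : R) :
  (forall A B, measurable A -> measurable B ->
     P (Y @^-1` A `&` X @^-1` B) = (P (Y @^-1` A) * P (X @^-1` B))%E) ->
  measurable E -> (forall y, (distribution P X (xsection E y) <= p%:E)%E) ->
  (P [set w | E (Y w, X w)] <= p%:E)%E.
Proof.
move=> indep mE Ep.
have mYX : measurable_fun [set: T] (fun w => (Y w, X w)) by exact: measurable_fun_pair.
pose YX : {mfun T >-> (T' * R)%type} :=
  HB.pack (fun w => (Y w, X w)) (isMeasurableFun.Build _ _ _ _ _ mYX).
have prodE := @product_measure_unique _ _ _ _ _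
  (distribution P Y) (distribution P X) (distribution P YX) indep E mE.
rewrite -[X in (X <= _)%E]prodE /product_measure1.
rewrite -[p%:E]mule1 -(@probability_setT _ _ _ (distribution P Y)) -integral_cst //.
apply: ge0_le_integral => //.
  exact: measurable_fun_xsection.
by move=> y _; apply: Ep.
Qed.

(** Quantifying over all measurable spaces avoids a sigma-algebra on [U -> R] and permits a coarser
    sigma-algebra on the sample space. *)
Definition measurable_functional (R : realType) (U : Type) (f : (U -> R) -> R) : Prop :=
  forall d (T : measurableType d) (Y : U -> T -> R),
    (forall u, measurable_fun [set: T] (Y u)) ->
    measurable_fun [set: T] (fun w => f (fun u => Y u w)).

Section independent_family.
Context d (T : measurableType d) (R : realType) (P : probability T R).
Variables (U : finType) (D : {set U}) (X : U -> {RV P >-> R}).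
Hypothesis indepX : mutually_independent D X.
Hypothesis detX : forall v, v \notin D -> exists c, forall w, X v w = c.

Let sample (w : T) : U -> R := fun v => X v w.

(** A pi-system generating the sigma-algebra of the entries of [D] other than [u]. *)
Definition cylinders_off (u : U) : set (set T) :=
  [set A | exists B : U -> set R, (forall v, measurable (B v)) /\
     A = \bigcap_(v in [set` D :\ u]) (X v @^-1` B v)].

Lemma measurable_cylinders_off u : cylinders_off u `<=` measurable.
Proof.
move=> _ [B [mB ->]]; apply: fin_bigcap_measurable => // v _.
exact: measurable_funPTI.
Qed.

Lemma setI_closed_cylinders_off u : setI_closed (cylinders_off u).
Proof.
move=> _ _ [B [mB ->]] [C [mC ->]]; exists (fun v => B v `&` C v); split.
  by move=> v; exact: measurableI.
by rewrite -bigcapI.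
Qed.

(* Dynkin's pi-lambda argument, for the measures A |-> P (A & B) and P A * P B. *)
Lemma indep_cylinders_off u A B : u \in D -> <<s cylinders_off u >> A -> measurable B ->
  P (A `&` X u @^-1` B) = (P A * P (X u @^-1` B))%E.
Proof.
move=> uD sA mB.
have mXB : measurable (X u @^-1` B) by exact: measurable_funPTI.
pose r : {nonneg R} := NngNum (fine_ge0 (measure_ge0 P (X u @^-1` B))).
have rE : r%:num%:E = P (X u @^-1` B) by rewrite /= fineK // fin_num_measure.
rewrite muleC -rE -[LHS]/(mrestr P mXB A) -[RHS]/(mscale r P A).
apply: (g_sigma_algebra_measure_unique (cylinders_off u)
  (@measurable_cylinders_off u) (fun=> setT)) => //.
- move=> _; exists (fun=> setT); split => //.
  by apply/seteqP; split.
- by apply/seteqP; split=> // w _; exists 0%N.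
- exact: setI_closed_cylinders_off.
- move=> _ [C [mC ->]]; set A' := \bigcap_(v in _) _.
  transitivity (P A' * P (X u @^-1` B))%E; last by rewrite muleC -rE.
  rewrite -[LHS]/(P (A' `&` X u @^-1` B)) /A' => {A'}.
  (* Putting B at the index u turns the intersection into a cylinder over all of [D], so
     independence applies to both sides. *)
  pose C' v := if v == u then B else C v.
  have mC' v : measurable (C' v) by rewrite /C'; case: eqP.
  have -> : \bigcap_(v in [set` D :\ u]) X v @^-1` C v =
            \bigcap_(v in [set` D :\ u]) X v @^-1` C' v.
    apply: eq_bigcapr => v /=; rewrite !inE => /andP[/negbTE vu _].
    by rewrite /C' vu.
  have -> : \bigcap_(v in [set` D :\ u]) X v @^-1` C' v `&` X u @^-1` B =
            \bigcap_(v in [set` D]) X v @^-1` C' v.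
    apply/seteqP; split=> [w [Cw Bw] v /= vD|w Cw].
      case: (eqVneq v u) => [->|vu]; first by rewrite /C' eqxx.
      by apply: Cw; rewrite /= !inE vu.
    split; last by have := Cw u uD; rewrite /C' eqxx.
    by move=> v /=; rewrite !inE => /andP[_ vD]; apply: Cw.
  rewrite !indepX //; last exact: subsetDl.
  have C'u : C' u = B by rewrite /C' eqxx.
  by rewrite (big_setD1 u) //= C'u muleC.
- move=> _; rewrite -[X in (X < _)%E]/(P (setT `&` X u @^-1` B)) setTI.
  exact: le_lt_trans (probability_le1 P mXB) (ltry 1).
Qed.

(** Slope and intercept do not involve the entry u, so they are independent of it, and the bound for
    fixed coefficients integrates. *)
Lemma affine_event_le (f : (U -> R) -> R) (u : U) (E : set ((R * R) * R)) (p : R) :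
  measurable_functional f -> u \in D -> measurable E ->
  (forall c, (distribution P (X u) (xsection E c) <= p%:E)%E) ->
  (P [set w | E ((slope f (sample w) u, f (update (sample w) u 0%R)), X u w)] <= p%:E)%E.
Proof.
move=> mf uD mE Ep.
(* The sample space with the sigma-algebra of the other entries of [D]; entries outside [D] are
   constant, hence measurable for it. *)
pose S : measurableType _ := g_sigma_algebraType (cylinders_off u).
have mX (v : U) : v != u -> measurable_fun [set: S] (X v : S -> R).
  move=> vu; case: (boolP (v \in D)) => [vD|/detX[c Xc]]; last first.
    by rewrite (_ : (X v : S -> R) = cst c) //; apply/funext.
  move=> _ B mB; rewrite setTI; apply: sub_sigma_algebra.
  exists (fun v' => if v' == v then B else setT); split.
    by move=> v'; case: eqP.
  apply/seteqP; split=> [w Bw v' /= _|w /(_ v)].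
    by case: eqP => [->|].
  by rewrite /= !inE vu vD eqxx; apply.
have mfu s : measurable_fun [set: S] (fun w => f (update (sample w) u s)).
  apply: (@mf _ S (fun v w => update (sample w) u s v)) => v.
  rewrite /update; case: eqVneq => [_|vu]; first exact: measurable_cst.
  exact: mX.
pose Y0 (w : T) := (slope f (sample w) u, f (update (sample w) u 0)).
have mY0 : measurable_fun [set: S] (Y0 : S -> R * R).
  apply: measurable_fun_pair; last exact: mfu.
  by apply: measurable_funB; exact: mfu.
have sub A : measurable A -> <<s cylinders_off u >> (Y0 @^-1` A).
  by move=> mA; have := mY0 measurableT A mA; rewrite setTI.
have mY : measurable_fun [set: T] Y0.
  move=> _ A mA; rewrite setTI; have := sub A mA; apply: smallest_sub.
    exact: sigma_algebra_measurable.
  exact: measurable_cylinders_off.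
pose Y : {mfun T >-> (R * R)%type} := HB.pack Y0 (isMeasurableFun.Build _ _ _ _ Y0 mY).
apply: (@probability_section_le _ _ _ _ _ P (X u) Y) => // A B mA mB.
by apply: indep_cylinders_off => //; exact: sub.
Qed.
End independent_family.

(** * Measurability and almost sure nonvanishing of multiaffine functions *)

Lemma measurable_functional_update (R : realType) (U : eqType) (f : (U -> R) -> R) u s :
  measurable_functional f -> measurable_functional (fun x => f (update x u s)).
Proof.
move=> mf d T Y mY; apply: (mf _ _ (fun v w => update (fun v => Y v w) u s v)) => v.
by rewrite /update; case: eqP => _; [exact: measurable_cst|exact: mY].
Qed.

Lemma measurable_functional_slope (R : realType) (U : eqType) (f : (U -> R) -> R) u :
  measurable_functional f -> measurable_functional (fun x => slope f x u).
Proof.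
move=> mf d T Y mY; apply: measurable_funB.
  by have := measurable_functional_update u 1 mf; apply.
by have := measurable_functional_update u 0 mf; apply.
Qed.

Lemma measurable_det_at (R : realType) (U : eqType) n (e : 'I_n -> 'I_n -> U) :
  measurable_functional (@det_at R U n e).
Proof.
move=> d T Y mY; rewrite /det_at /determinant.
apply: measurable_sum => s; apply: measurable_funM; first exact: measurable_cst.
by apply: measurable_prod => i _; under eq_fun do rewrite mxE; exact: mY.
Qed.

Lemma measurable_eq0 d (T : measurableType d) (R : realType) (h : T -> R) :
  measurable_fun [set: T] h -> measurable [set w | h w = 0].
Proof.
by move=> mh; rewrite -[X in measurable X]setTI; exact: (mh measurableT [set 0]).
Qed.

Section zero_set.
Context d (T : measurableType d) (R : realType) (P : probability T R).
Variables (U : finType) (D : {set U}) (X : U -> {RV P >-> R}).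
Hypothesis indepX : mutually_independent D X.
Hypothesis detX : forall v, v \notin D -> exists c, forall w, X v w = c.
Hypothesis atomless : forall u, u \in D -> forall r, distribution P (X u) [set r] = 0%E.

Let sample (w : T) : U -> R := fun v => X v w.

Let measurable_sample (f : (U -> R) -> R) :
  measurable_functional f -> measurable_fun [set: T] (fun w => f (sample w)).
Proof. by move=> mf; apply: (mf _ _ (fun u w => X u w)) => u. Qed.

(** For a fixed slope c0 <> 0 and intercept c1 the only zero is - c1 / c0, which an atomless law
    does not charge. *)
Lemma multiaffine_zero_slope (f : (U -> R) -> R) u :
  measurable_functional f -> multiaffine f -> u \in D ->
  P [set w | slope f (sample w) u != 0 /\ f (sample w) = 0] = 0%E.
Proof.
move=> mf maf uD; apply/eqP; rewrite -measure_le0.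
pose E : set ((R * R) * R) := [set p | p.1.1 != 0 /\ p.2 * p.1.1 + p.1.2 = 0].
have m11 : measurable_fun [set: (R * R) * R] (fun p => p.1.1).
  by apply: measurableT_comp.
have m12 : measurable_fun [set: (R * R) * R] (fun p => p.1.2).
  by apply: measurableT_comp.
have mE : measurable E.
  have -> : E = ~` [set p | p.1.1 = 0] `&` [set p | p.2 * p.1.1 + p.1.2 = 0].
    by apply/seteqP; split=> p [] /eqP.
  apply: measurableI; first by apply: measurableC; exact: measurable_eq0.
  apply: measurable_eq0; apply: measurable_funD => //; exact: measurable_funM.
have := @affine_event_le _ _ _ P U D X indepX detX f u E 0 mf uD mE.
rewrite (_ : [set w | _] = [set w | slope f (sample w) u != 0 /\ f (sample w) = 0]).
  apply=> -[c0 c1]; have [->|c00] := eqVneq c0 0.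
    rewrite (_ : xsection _ _ = set0) ?measure0 //.
    by apply/seteqP; split=> // x; rewrite /xsection /= inE => -[]; rewrite eqxx.
  rewrite (_ : xsection _ _ = [set - c1 / c0]) ?atomless //.
  apply/seteqP; split=> x; rewrite /xsection /= inE /E /=.
    by move=> [_ /eqP]; rewrite addr_eq0 => /eqP <-; rewrite mulfK.
  by move=> ->; split=> //; rewrite divfK // addNr.
by apply/seteqP; split=> w /=; rewrite (multiaffineE (sample w) u maf).
Qed.

(* Starting from x0, the entries are replaced one at a time by the random ones:
   if the slope in the new entry vanishes, then so does the previous value. *)
Lemma multiaffine_neq0_ae (f : (U -> R) -> R) (x0 : U -> R) :
  measurable_functional f -> multiaffine f ->
  (forall v, v \notin D -> forall w, X v w = x0 v) -> f x0 != 0 ->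
  P [set w | f (sample w) = 0] = 0%E.
Proof.
move=> mf maf offD fx0.
(* Entries listed in s are variable, the others are frozen at [x0]. *)
pose mix (s : seq U) (x : U -> R) v := if v \in s then x v else x0 v.
have mmix s : measurable_functional (fun x => f (mix s x)).
  move=> d' T' Y mY; apply: (mf _ _ (fun v w => mix s (fun v => Y v w) v)) => v.
  by rewrite /mix; case: (v \in s); [exact: mY|exact: measurable_cst].
have mix_update s u t x : u \in s -> mix s (update x u t) = update (mix s x) u t.
  move=> us; apply/funext => v; rewrite /mix /update.
  by case: (eqVneq v u) => [->|//]; rewrite us.
have mamix s : multiaffine (fun x => f (mix s x)).
  move=> x u t; rewrite /slope; case: (boolP (u \in s)) => us.
    by rewrite !mix_update //; exact: maf.
  have same t' : mix s (update x u t') = mix s x.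
    apply/funext => v; rewrite /mix /update; case: (eqVneq v u) => [->|//].
    by rewrite (negbTE us).
  by rewrite !same subrr mulr0 add0r.
have null s : uniq s -> {subset s <= D} -> P [set w | f (mix s (sample w)) = 0] = 0%E.
  elim: s => [_ _|u s IHs /= /andP[us uniqs] sD].
    rewrite (_ : [set _ | _] = set0) ?measure0 //.
    by apply/seteqP; split=> // w /= /eqP; rewrite (negbTE fx0).
  have uD : u \in D by apply: sD; rewrite mem_head.
  have {}IHs : P [set w | f (mix s (sample w)) = 0] = 0%E.
    by apply: IHs => // v vs; apply: sD; rewrite inE vs orbT.
  have slope0 := multiaffine_zero_slope (mmix (u :: s)) (mamix (u :: s)) uD.
  pose g x := f (mix (u :: s) x).
  pose N1 : set T := [set w | slope g (sample w) u != 0 /\ g (sample w) = 0].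
  pose N2 : set T := [set w | f (mix s (sample w)) = 0].
  have mN1 : measurable N1.
    have -> : N1 =
        ~` [set w | slope g (sample w) u = 0] `&` [set w | g (sample w) = 0].
      by apply/seteqP; split=> w [] /eqP.
    apply: measurableI; last by apply: measurable_eq0; exact: (measurable_sample (mmix (u :: s))).
    apply: measurableC; apply: measurable_eq0.
    apply: (measurable_sample (f := fun x => slope g x u)).
    by apply: measurable_functional_slope; exact: mmix.
  have mN2 : measurable N2.
    by apply: measurable_eq0; exact: (measurable_sample (mmix s)).
  apply/eqP; rewrite -measure_le0.
  have N12 : (P (N1 `|` N2) <= 0)%E.
    apply: (le_trans (measureU2 P mN1 mN2)); rewrite -[leRHS]adde0.
    by apply: leeD; rewrite le_eqVlt; apply/orP; left; apply/eqP; [exact: slope0|exact: IHs].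
  apply: le_trans N12; apply: le_measure; rewrite ?inE.
  - by apply: measurable_eq0; exact: (measurable_sample (mmix (u :: s))).
  - exact: measurableU.
  - move=> w /= gw0; have [s0|s0] := eqVneq (slope g (sample w) u) 0; last by left; split.
    right; rewrite /N2 /=; have -> : mix s (sample w) = mix (u :: s) (update (sample w) u (x0 u)).
      apply/funext => v; rewrite /mix /update inE.
      by case: (eqVneq v u) => [->|//]; rewrite (negbTE us).
    have gma : multiaffine g := mamix (u :: s).
    rewrite -[LHS]/(g (update (sample w) u (x0 u))) gma s0 mulr0 add0r.
    by have := multiaffineE (sample w) u gma; rewrite s0 mulr0 add0r => <-.
(* Once all of [D] is listed the mixture is the sample itself, which equals [x0] outside [D]. *)
rewrite -(null (enum D)) ?enum_uniq //; last by move=> u; rewrite mem_enum.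
congr (P _); apply/seteqP; split=> w /=; (suff -> : mix (enum D) (sample w) = sample w by []);
apply/funext => v; rewrite /mix mem_enum; case: ifPn => // vD; by rewrite /sample (offD v vD).
Qed.

End zero_set.

(** * The Gaussian ratio estimate *)

(** The set lies in an interval of radius r = u / (t - 1), and |x| >= u on it, so its probability is
    at most 2 r phi(u) = 2 u phi(u) / (t - 1). *)
Lemma normal_prob_ratio_le (R : realType) (t z : R) : 1 < t ->
  (normal_prob 0 1 [set x : R | t * `|x + z| <= `|x|]%R <= (8 / 13 / (t - 1))%:E)%E.
Proof.
move=> t1.
have s0 : 0 < t ^+ 2 - 1 by nra.
(* The points - z t / (t - 1) and - z t / (t + 1) solve t |x + z| = |x|; c is their midpoint, r half
   their distance, u the smaller absolute value. *)
set r := `|z| * t / (t ^+ 2 - 1); set c := - (z * t ^+ 2 / (t ^+ 2 - 1)).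
set u := `|z| * t / (t + 1).
have u0 : 0 <= u by rewrite /u; apply: divr_ge0; [apply: mulr_ge0 => //; lra|lra].
have ru : r = u / (t - 1).
  by rewrite /r /u subr_sqr_1; field; apply/andP; split; lra.
set A := [set x : R | _].
have mA : measurable A.
  rewrite -[A]setTI; apply: measurable_fun_le => //.
    by apply: measurable_funM => //; apply: measurableT_comp => //; exact: measurable_funD.
have Au x : A x -> u <= `|x|.
  move=> Ax; rewrite /u ler_pdivrMr; last by lra.
  have : `|z| <= `|x + z| + `|x|.
    by rewrite -[`|x|]normrN; apply: le_trans (ler_normD _ _); rewrite addrC addrA addNr add0r.
  have := Ax; rewrite /A /=; nra.
have Aitv : A `<=` `[c - r, c + r]%classic.
  move=> x /= Ax; rewrite in_itv /= -ler_distlC distrC.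
  (* Completing the square in t^2 (x + z)^2 <= x^2 after multiplication by t^2 - 1. *)
  have sq : ((t ^+ 2 - 1) * x + t ^+ 2 * z) ^+ 2 <= (t * `|z|) ^+ 2.
    have : (t * `|x + z|) ^+ 2 <= `|x| ^+ 2.
      by rewrite ler_sqr ?nnegrE // mulr_ge0 //; lra.
    rewrite !exprMn !real_normK ?num_real // => H.
    rewrite -subr_ge0 (_ : _ - _ = (t ^+ 2 - 1) * (x ^+ 2 - t ^+ 2 * (x + z) ^+ 2)); last by ring.
    by apply: mulr_ge0; [exact: ltW|rewrite subr_ge0].
  have -> : x - c = ((t ^+ 2 - 1) * x + t ^+ 2 * z) / (t ^+ 2 - 1).
    by rewrite /c; field; rewrite gt_eqF.
  rewrite normrM normfV (gtr0_norm s0) /r ler_pM2r ?invr_gt0 //.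
  rewrite -ler_sqr ?nnegrE //; last by apply: mulr_ge0 => //; lra.
  by rewrite real_normK ?num_real // [leRHS]exprMn -[leRHS]exprMn [_ * t]mulrC.
pose M := normal_pdf 0 1 u.
have M0 : 0 <= M by exact: normal_pdf_ge0.
have pdfM x : A x -> normal_pdf 0 1 x <= M.
  move=> /Au ux; rewrite /M !normal_pdfE ?oner_neq0 //.
  rewrite ler_wpM2l ?normal_peak_ge0 // /normal_fun ler_expR ler_pM2r; last first.
    by rewrite invr_gt0 expr1n; lra.
  by rewrite !subr0 lerN2 -(real_normK (num_real x)) ler_sqr ?nnegrE.
(* M u is maximal at u = 1, with value (2 pi e)^(-1/2); the crude bounds pi >= 2
   and e >= (21/20)^20 suffice. *)
have Mu : M * u <= 4 / 13.
  rewrite /M normal_pdfE ?oner_neq0 // /normal_peak /normal_fun subr0 expr1n mul1r.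
  set q := Num.sqrt _.
  have q2 : 2 <= q.
    rewrite -[leLHS](ger0_norm (ler0n _ 2)) -sqrtr_sqr; apply: ler_wsqrtr.
    by have := @pi_ge2 R; rewrite expr2 mulr2n; lra.
  have e_ge : (21 / 20) ^+ 10 <= expR (1 / 2 : R).
    have -> : (1 / 2 : R) = 10%:R * (1 / 20) by field.
    have e1 : 21 / 20 <= expR (1 / 20 : R) by apply: le_trans (expR_ge1Dx _); lra.
    by rewrite expRM_natl lerXn2r ?nnegrE ?expR_ge0 //; lra.
  (* Uses u <= 1 + (u^2 - 1) / 2 <= exp((u^2 - 1) / 2). *)
  have ue : u * expR (- u ^+ 2 / (1 *+ 2)) <= expR (- (1 / 2)).
    have -> : - u ^+ 2 / (1 *+ 2) = - (1 / 2) - (u ^+ 2 - 1) / 2 by rewrite mulr2n; field.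
    rewrite expRB mulrCA ler_piMr ?expR_ge0 // ler_pdivrMr ?expR_gt0 // mul1r.
    have := expR_ge1Dx ((u ^+ 2 - 1) / 2); have := sqr_ge0 (u - 1).
    rewrite sqrrB1; lra.
  rewrite -mulrA [_ * u]mulrC ler_pdivrMl; last by lra.
  apply: (le_trans ue); rewrite expRN -[leLHS]mul1r ler_pdivrMr ?expR_gt0 //.
  have qe : 2 * (21 / 20) ^+ 10 <= q * expR (1 / 2).
    by apply: ler_pM => //; lra.
  lra.
rewrite /normal_prob.
apply: (@le_trans _ _ (\int[lebesgue_measure]_(x in A) M%:E)%E).
  apply: ge0_le_integral => //.
  - by move=> x _; rewrite lee_fin normal_pdf_ge0.
  - by apply/measurable_EFinP; apply: measurable_funTS; exact: measurable_normal_pdf.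
apply: (@le_trans _ _ (\int[lebesgue_measure]_(x in `[(c - r)%R, (c + r)%R]) M%:E)%E).
  by apply: ge0_subset_integral => //.
rewrite integral_cst //= lebesgue_measure_itv /=.
have r0 : 0 <= r by rewrite ru; apply: divr_ge0 => //; lra.
have bound : M * (2 * r) <= 8 / 13 / (t - 1).
  have -> : M * (2 * r) = 2 * (M * u) / (t - 1) by rewrite ru; field; lra.
  by rewrite ler_pM2r ?invr_gt0; lra.
(* For z = 0 the interval is a point and the length formula takes its value 0. *)
case: ifP => _; last first.
  by rewrite mule0 lee_fin; apply: divr_ge0; lra.
rewrite -EFinB -EFinM lee_fin.
by have -> : c + r - (c - r) = 2 * r by ring.
Qed.

Lemma normal_prob_set1 (R : realType) (r : R) : normal_prob 0 1 [set r] = 0%E.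
Proof. by rewrite /normal_prob integral_set1. Qed.

Lemma normal_prob_affine_ratio_le (R : realType) (t c0 c1 : R) : 1 < t -> c0 != 0 ->
  (normal_prob 0 1 [set x : R | t * `|x * c0 + c1| <= `|x * c0|]%R
     <= (8 / 13 / (t - 1))%:E)%E.
Proof.
move=> t1 c00; rewrite (_ : [set x | _] = [set x : R | t * `|x + c1 / c0| <= `|x|]).
  exact: normal_prob_ratio_le.
have E x : (t * `|x * c0 + c1| <= `|x * c0|) = (t * `|x + c1 / c0| <= `|x|).
  have -> : x * c0 + c1 = (x + c1 / c0) * c0 by rewrite mulrDl divfK.
  by rewrite !normrM mulrA ler_pM2r ?normr_gt0.
by apply/seteqP; split=> x /=; rewrite E.
Qed.

(** Here exp(21/50) >= (1 + 21/400)^8 >= 3/2. The constant is sharp enough for the closing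
    comparison of the expectation bound with 1. *)
Lemma ln_three_halves_le (R : realType) : ln (3 / 2 : R) <= 21 / 50.
Proof.
rewrite -[leRHS]expRK ler_ln ?posrE ?expR_gt0 ?divr_gt0 //.
have -> : (21 / 50 : R) = 8%:R * (21 / 400) by field.
rewrite expRM_natl; apply: (@le_trans _ _ ((421 / 400) ^+ 8)); first by lra.
have e1 : 421 / 400 <= expR (21 / 400 : R) by apply: le_trans (expR_ge1Dx _); lra.
apply: lerXn2r e1; rewrite nnegrE; [lra|exact: expR_ge0].
Qed.

(** * Expectation of a logarithm from geometric tails *)

(** The integral of a nonnegative function is a supremum over the simple functions below it, hence
    monotone; the logarithm of the condition number can thus be bounded without proving it
    measurable. *)
Lemma ge0_le_integral_nonmeas d (T : measurableType d) (R : realType)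
    (mu : {measure set T -> \bar R}) (f g : T -> \bar R) :
  (forall w, 0 <= f w)%E -> (forall w, f w <= g w)%E ->
  (\int[mu]_w f w <= \int[mu]_w g w)%E.
Proof.
move=> f0 fg; have g0 w : (0 <= g w)%E by exact: le_trans (fg w).
rewrite !ge0_integralTE //; apply: le_ereal_sup => _ [h hf <-].
by exists h => // w; exact: le_trans (fg w).
Qed.

Lemma log_plus_le (R : realType) (beta y : R) (c : \bar R) :
  1 < beta -> 1 <= y -> (c <= y%:E)%E -> (log_plus beta c <= (log_base beta y)%:E)%E.
Proof.
move=> b1 y1; have lb : 0 < ln beta by exact: ln_gt0.
have ly : (0 <= (log_base beta y)%:E)%E.
  by rewrite lee_fin /log_base divr_ge0 ?ln_ge0 // ltW.
case: c => [r||] //=; rewrite lee_fin => ry.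
case: ifP => // r1; rewrite lee_fin /log_base ler_pM2r ?invr_gt0 // ler_ln ?posrE //.
  by exact: lt_le_trans r1.
by exact: lt_le_trans y1.
Qed.

Lemma log_plus_ge0 (R : realType) (beta : R) (c : \bar R) :
  1 < beta -> (0 <= log_plus beta c)%E.
Proof.
move=> b1; case: c => [r||] //=; case: ifP => // r1.
by rewrite lee_fin /log_base divr_ge0 ?ln_ge0 // ltW.
Qed.

Lemma geometric_eseries_le (R : realType) (a z : R) : 0 <= a -> 0 <= z < 1 ->
  (\sum_(j <oo) (a * z ^+ j)%:E <= (a / (1 - z))%:E)%E.
Proof.
move=> a0 /andP[z0 z1].
apply: lime_le; first by apply: is_cvg_nneseries => j _ _; rewrite lee_fin mulr_ge0 ?exprn_ge0.
near=> m; rewrite sumEFin lee_fin.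
have := congr1 (fun u => u m) (geometric_seriesE a (negbT (lt_eqF z1))).
rewrite /series /= => ->.
rewrite ler_pM2r ?invr_gt0 ?subr_gt0 // ler_piMr // gerBl exprn_ge0 //.
Unshelve. all: end_near.
Qed.

(** If j is the least index with w outside E_j, then log_+ c(w) <= log K + j log rho, and j is at
    most the number of sets E_i containing w. Integrating the sum of indicators gives a geometric
    series. *)
Lemma integral_log_plus_le d (T : measurableType d) (R : realType) (P : probability T R)
    (c : T -> \bar R) (beta K rho q : R) (E : nat -> set T) :
  1 < beta -> 1 <= K -> 1 < rho -> 0 <= q ->
  (forall j, measurable (E j)) -> (forall j, P (E j) <= (q * rho^-1 ^+ j)%:E)%E ->
  (forall j w, ~ E j w -> (c w <= (K * rho ^+ j)%:E)%E) ->
  (\int[P]_w log_plus beta (c w) <=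
     (log_base beta K + ln rho / ln beta * (q / (1 - rho^-1)))%:E)%E.
Proof.
move=> b1 K1 rho1 q0 mE PE cE.
have lb : 0 < ln beta by exact: ln_gt0.
have lr : 0 < ln rho by exact: ln_gt0.
set h := ln rho / ln beta; have h0 : 0 <= h by rewrite divr_ge0 // ltW.
set L := log_base beta K.
have L0 : 0 <= L by rewrite divr_ge0 ?ln_ge0 // ltW.
have K0 : 0 < K by exact: lt_le_trans K1.
have rho0 : 0 < rho by exact: lt_trans rho1.
pose g j (w : T) : \bar R := (h * \1_(E j) w)%:E.
have g0 j w : (0 <= g j w)%E by rewrite lee_fin mulr_ge0.
have mg j : measurable_fun [set: T] (g j).
  by apply/measurable_EFinP; apply: measurable_funM.
have logE j : log_base beta (K * rho ^+ j) = L + h *+ j.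
  rewrite /log_base lnM ?posrE ?exprn_gt0 // lnXn // mulrDl -/L /h; congr (_ + _).
  by rewrite mulrnAl.
apply: (@le_trans _ _ (\int[P]_w (L%:E + \sum_(j <oo) g j w))%E).
  apply: ge0_le_integral_nonmeas => w; first exact: log_plus_ge0.
  (* At a point of all the E_j the value of c may be infinite, but there the series diverges. *)
  have [allE|] := pselect (forall j, E j w).
    suff -> : (\sum_(j <oo) g j w = +oo)%E by rewrite addey ?leey.
    apply/eqyP => A A0; apply: le_trans (nneseries_lim_ge (Num.trunc (A / h)).+1 _) => //.
    rewrite (eq_bigr (fun=> h%:E)); last by move=> j _; rewrite /g indicE mem_set ?mulr1.
    rewrite sumEFin lee_fin sumr_const_nat subn0 -mulr_natr mulrC -ler_pdivrMr ?divr_gt0 //.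
    exact/ltW/truncnS_gt.
  move=> /existsNP exE.
  have {}exE : exists j, `[< ~ E j w >] by case: exE => j /asboolP; exists j.
  case: (ex_minnP exE) => j /asboolP Ej minj.
  apply: le_trans (log_plus_le b1 _ (cE j w Ej)) _.
    by rewrite -[1]mulr1 ler_pM // exprn_ege1 // ltW.
  rewrite logE EFinD leeD2l //.
  apply: le_trans (nneseries_lim_ge j _) => //.
  rewrite big_nat_cond (eq_bigr (fun=> h%:E)) -?big_nat_cond.
    by rewrite sumEFin lee_fin sumr_const_nat subn0.
  move=> i /andP[/andP[_ ij] _]; rewrite /g indicE mem_set ?mulr1 //.
  by apply: contrapT => /asboolP /minj; rewrite leqNgt ij.
rewrite ge0_integralD //; last 2 first.
- by move=> w _; exact: nneseries_ge0.
- exact: ge0_emeasurable_sum.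
rewrite integral_cst //= probability_setT mule1 EFinD leeD2l //.
rewrite integral_nneseries //.
rewrite mulrA; apply: le_trans (geometric_eseries_le _ _); last 2 first.
- exact: mulr_ge0.
- by rewrite invr_ge0 ltW //= invf_lt1.
apply: lee_nneseries => [j _ _|j _].
  by apply: integral_ge0.
rewrite /g; under eq_integral do rewrite EFinM.
rewrite ge0_integralZl //=; last first.
  by apply/measurable_EFinP.
rewrite integral_indic // setIT -mulrA [leRHS]EFinM.
by apply: lee_wpmul2l; rewrite ?lee_fin //; exact: PE.
Qed.

(** * Random systems *)

Lemma measure_bigcup_seq_le d (T : measurableType d) (R : realType)
    (mu : {measure set T -> \bar R}) (I : eqType) (r : seq I) (A : I -> set T) (p : R) :
  (forall i, measurable (A i)) -> (forall i, i \in r -> mu (A i) <= p%:E)%E ->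
  (mu (\big[setU/set0]_(i <- r) A i) <= ((size r)%:R * p)%:E)%E.
Proof.
move=> mA; elim: r => [|i r IH] Ap; first by rewrite big_nil measure0 mul0r.
rewrite big_cons /=; apply: (le_trans (measureU2 mu (mA i) _)).
  exact: bigsetU_measurable.
have -> : (size r).+1%:R * p = p + (size r)%:R * p by rewrite -natr1; ring.
rewrite EFinD; apply: leeD; [exact/Ap/mem_head|].
by apply: IH => l lr; apply: Ap; rewrite inE lr orbT.
Qed.

Section gaussian_family.
Context d (T : measurableType d) (R : realType) (P : probability T R).
Variables (U : finType) (D : {set U}) (X : U -> {RV P >-> R}).
Hypothesis indepX : mutually_independent D X.
Hypothesis gaussX : forall u, u \in D -> standard_gaussian (X u).

Let sample (w : T) : U -> R := fun v => X v w.

(** Stated without division, so that the event contains the zeros of f; outside it f is nonzero. *)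
Definition large_sensitivity (f : (U -> R) -> R) (t : R) (u : U) : set T :=
  [set w | t * `|f (sample w)| <= `|X u w * slope f (sample w) u|].

Lemma measurable_large_sensitivity f t u :
  measurable_functional f -> measurable (large_sensitivity f t u).
Proof.
move=> mf; rewrite -[large_sensitivity _ _ _]setTI; apply: measurable_fun_le => //.
  apply: measurable_funM => //; apply: measurableT_comp => //.
  exact: (mf _ _ (fun u w => X u w)).
apply: measurableT_comp => //; apply: measurable_funM => //.
have mslope : measurable_functional (slope f ^~ u) by exact: measurable_functional_slope.
exact: (mslope _ _ (fun u w => X u w)).
Qed.

(** Where the slope is nonzero the Gaussian ratio estimate applies to f = u f_u + f_0; where it
    vanishes the event forces f = 0, which has probability 0. *)
Lemma large_sensitivity_le (f : (U -> R) -> R) (x0 : U -> R) (t : R) (u : U) :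
  measurable_functional f -> multiaffine f ->
  (forall v, v \notin D -> forall w, X v w = x0 v) -> f x0 != 0 ->
  1 < t -> u \in D ->
  (P (large_sensitivity f t u) <= (8 / 13 / (t - 1))%:E)%E.
Proof.
move=> mf maf offD fx0 t1 uD.
have detX v : v \notin D -> exists c, forall w, X v w = c.
  by move=> vD; exists (x0 v) => w; exact: offD.
have atomless v : v \in D -> forall r, distribution P (X v) [set r] = 0%E.
  by move=> vD r; rewrite gaussX // normal_prob_set1.
have null := multiaffine_neq0_ae indepX detX atomless mf maf offD fx0.
pose E : set ((R * R) * R) :=
  [set p | p.1.1 != 0 /\ t * `|p.2 * p.1.1 + p.1.2| <= `|p.2 * p.1.1|].
have m11 : measurable_fun [set: (R * R) * R] (fun p => p.1.1) by exact: measurableT_comp.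
have m12 : measurable_fun [set: (R * R) * R] (fun p => p.1.2) by exact: measurableT_comp.
have m2 : measurable_fun [set: (R * R) * R] (fun p => p.2 * p.1.1) by exact: measurable_funM.
have mE : measurable E.
  have -> : E = ~` [set p | p.1.1 = 0] `&`
      [set p | t * `|p.2 * p.1.1 + p.1.2| <= `|p.2 * p.1.1|].
    by apply/seteqP; split=> p [] /eqP.
  apply: measurableI; first by apply: measurableC; exact: measurable_eq0.
  rewrite -[X in measurable X]setTI; apply: measurable_fun_le => //.
    apply: measurable_funM => //; apply: measurableT_comp => //.
    exact: measurable_funD.
  exact: measurableT_comp.
have PE : (P [set w | E ((slope f (sample w) u, f (update (sample w) u 0%R)), X u w)]
    <= (8 / 13 / (t - 1))%:E)%E.
  apply: (affine_event_le indepX detX) => // -[c0 c1].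
  have [c00|c00] := eqVneq c0 0.
    have -> : xsection E (c0, c1) = set0.
      by apply/seteqP; split=> // x; rewrite /xsection /= inE => -[] /=; rewrite c00 eqxx.
    by rewrite measure0 lee_fin; apply: divr_ge0; lra.
  have -> : xsection E (c0, c1) = [set x | t * `|x * c0 + c1| <= `|x * c0|].
    apply/seteqP; split=> x; rewrite /xsection /= inE; first by case.
    by move=> ?; split.
  rewrite gaussX //; first exact: normal_prob_affine_ratio_le.
  rewrite -[X in measurable X]setTI; apply: measurable_fun_le => //.
    apply: measurable_funM => //; apply: measurableT_comp => //.
    by apply: measurable_funD => //; exact: measurable_funM.
  by apply: measurableT_comp => //; exact: measurable_funM.
set E' := [set w | _] in PE.
have mE' : measurable E'.
  have mpair : measurable_fun [set: T]
      (fun w => ((slope f (sample w) u, f (update (sample w) u 0)), X u w)).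
    apply: measurable_fun_pair => //; apply: measurable_fun_pair.
      have mslope : measurable_functional (slope f ^~ u) by exact: measurable_functional_slope.
      exact: (mslope _ _ (fun u w => X u w)).
    have mupd : measurable_functional (fun x => f (update x u 0)).
      exact: measurable_functional_update.
    exact: (mupd _ _ (fun u w => X u w)).
  by rewrite -[E']setTI; exact: mpair.
pose N : set T := [set w | f (sample w) = 0].
have mN : measurable N.
  by apply: measurable_eq0; exact: (mf _ _ (fun u w => X u w)).
have sub : large_sensitivity f t u `<=` E' `|` N.
  move=> w; rewrite /large_sensitivity /= => le_w.
  have fE := multiaffineE (sample w) u maf.
  have [s0|s0] := eqVneq (slope f (sample w) u) 0.
    right; rewrite /N /=; apply/eqP; rewrite -normr_le0.
    by move: le_w; rewrite s0 mulr0 normr0 pmulr_rle0 //; lra.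
  by left; split=> //=; rewrite -fE.
apply: (@le_trans _ _ (P (E' `|` N))).
  apply: le_measure => //; rewrite inE.
    exact: measurable_large_sensitivity.
  exact: measurableU.
apply: (le_trans (measureU2 P mE' mN)); rewrite -[leRHS]adde0.
by apply: leeD => //; rewrite le_eqVlt; apply/orP; left; apply/eqP; exact: null.
Qed.

End gaussian_family.

(** A nonsingular matrix has no zero row, so S meets every row. The bound later absorbs n into
    |S|. *)
Lemma card_pattern_ge (R : realType) n (S : {set 'I_n * 'I_n}) (M : 'M[R]_n) :
  pattern_mx S M -> M \in unitmx -> (n <= #|S|)%N.
Proof.
move=> MS uM.
have rowS i : exists j, (i, j) \in S.
  apply: contrapT => none; move: uM; rewrite unitmxE (expand_det_row _ i) big1 ?unitr0 //.
  by move=> j _; rewrite MS ?mul0r //; apply/negP => ijS; apply: none; exists j.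
pose j i := xchoose (rowS i).
rewrite -[leqLHS]card_ord -(card_imset (f := fun i => (i, j i))) //; last by move=> i i' [].
apply: subset_leq_card; apply/fintype.subsetP => _ /imsetP[i _ ->].
exact: xchooseP (rowS i).
Qed.

(** * Expected logarithm of the condition number *)

Unset Implicit Arguments.

Theorem corollary3 (R : realType) (n : nat) (n_gt0 : (0 < n)%N)
    (beta : R) (beta_gt1 : 1 < beta) (S : {set 'I_n * 'I_n})
    (S_nonsing : ~ (@pattern_mx R n S `<=` @singular_mx R n))
    (d : measure_display) (T : measurableType d) (P : probability T R)
    (a : 'I_n -> 'I_n -> {RV P >-> R}) (b : 'I_n -> {RV P >-> R})
    (ab_gaussian : gaussian_system S a b) :
  (\int[P]_w log_plus beta
      (cond_linear (\matrix_(i < n, j < n) a i j w) (\col_(i < n) b i w))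
   <= (log_base beta n%:R + 2 * log_base beta #|S|%:R + log_base beta 10
       + 1 / ln beta)%:E)%E.
Proof.
have [M [MS uM]] : exists M : 'M[R]_n, pattern_mx S M /\ M \in unitmx.
  apply: contrapT => none; apply: S_nonsing => M MS; apply/negP => uM.
  by apply: none; exists M.
have leS := card_pattern_ge MS uM.
case: ab_gaussian => offS gauss indep.
set D := free_entries S in gauss indep; set X := entries a b in gauss indep.
pose sample (w : T) : 'I_n * 'I_n + 'I_n -> R := fun u => X u w.
(* The right-hand side is column k of M, so replacing column k by it returns M, and both
   determinants equal det M. *)
pose x0 k (u : 'I_n * 'I_n + 'I_n) : R :=
  match u with inl p => M p.1 p.2 | inr i => M i k end.
have offD k v : v \notin D -> forall w, X v w = x0 k v.
  case: v => [[i j]|i]; rewrite inE //= => ijS w.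
  by rewrite offS // MS.
have detM : \det M != 0 by rewrite -unitfE -unitmxE.
have det0 k : sys_det (x0 k) != 0.
  rewrite (_ : sys_det _ = \det M) //; congr (\det _).
  by apply/matrixP => i j; rewrite mxE.
have cramer0 k : cramer_det k (x0 k) != 0.
  rewrite (_ : cramer_det _ _ = \det M) //; congr (\det _).
  by apply/matrixP => i j; rewrite mxE /cramer_index; case: eqP => [->|].
have mdet : measurable_functional (@sys_det R n) :=
  @measurable_det_at R _ n (fun i j => inl (i, j)).
have mcramer k : measurable_functional (@cramer_det R n k) :=
  @measurable_det_at R _ n (cramer_index k).
have n0 : 0 < n%:R :> R by rewrite ltr0n.
have n1 : 1 <= n%:R :> R by rewrite ler1n.
have nS : n%:R <= #|S|%:R :> R by rewrite ler_nat.
set s : R := #|S|%:R in nS *.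
(* 3 |S| t_j = 10 n |S|^2 (3/2)^j, and at most 3 |S| sensitivities add up. *)
pose t j : R := 10 / 3 * (n%:R * s) * (3 / 2) ^+ j.
have t_ge j : 10 / 3 <= t j.
  have e1 : 1 <= (3 / 2 : R) ^+ j by apply: exprn_ege1; lra.
  have ns1 : 1 <= n%:R * s by nra.
  by rewrite /t; nra.
(* For det A only the |S| free entries of A matter; each of the n Cramer determinants is tested
   against all |S| + n free entries. *)
pose E j : set T :=
  \big[setU/set0]_(p <- enum S) large_sensitivity X (@sys_det R n) (t j) (inl p) `|`
  \big[setU/set0]_(k <- enum 'I_n) \big[setU/set0]_(u <- enum D)
     large_sensitivity X (cramer_det k) (t j) u.
have mE j : measurable (E j).
  apply: measurableU; apply: bigsetU_measurable => p _.
    exact: measurable_large_sensitivity.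
  by apply: bigsetU_measurable => u _; exact: measurable_large_sensitivity.
have sizeD : (size (enum D))%:R = s + n%:R.
  have -> : n%:R = #|'I_n|%:R :> R by rewrite card_ord.
  rewrite -cardE /s -natrD; congr (_%:R).
  have -> : D = [set inl p | p in S]%SET :|: [set inr i | i in 'I_n]%SET.
    apply/setP => -[p|i]; rewrite !inE /=.
      rewrite mem_imset; last by move=> ? ? [].
      by case: (boolP (p \in S)) => //= _; apply/esym/imsetP => -[].
    by apply/esym/orP; right; apply: imset_f.
  rewrite cardsU (_ : _ :&: _ = finset.set0) ?cards0 ?subn0.
    by rewrite !card_imset // => ? ? [].
  by apply/setP => -[p|i]; rewrite !inE; apply/andP => -[/imsetP[? ? ?] /imsetP[]].
have PE j : (P (E j) <= (72 / 91 * (3 / 2)^-1 ^+ j)%:E)%E.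
  have tj := t_ge j.
  set p := 8 / 13 / (t j - 1).
  have p0 : 0 <= p by apply: divr_ge0; lra.
  have P1 : (P (\big[setU/set0]_(q <- enum S)
      large_sensitivity X (@sys_det R n) (t j) (inl q)) <= (s * p)%:E)%E.
    rewrite /s cardE; apply: measure_bigcup_seq_le => q.
      exact: measurable_large_sensitivity.
    rewrite mem_enum => qS; have [k] : exists k : 'I_n, true by exists (Ordinal n_gt0).
    move=> _; apply: (@large_sensitivity_le _ _ _ _ _ D X indep gauss _ (x0 k)) => //.
    - exact: multiaffine_sys_det.
    - exact: offD.
    - by lra.
    - by rewrite inE.
  have P2 : (P (\big[setU/set0]_(k <- enum 'I_n) \big[setU/set0]_(u <- enum D)
      large_sensitivity X (cramer_det k) (t j) u) <= (n%:R * ((s + n%:R) * p))%:E)%E.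
    rewrite -[n in n%:R * _](size_enum_ord n); apply: measure_bigcup_seq_le => k.
      by apply: bigsetU_measurable => u _; exact: measurable_large_sensitivity.
    move=> _; rewrite -sizeD; apply: measure_bigcup_seq_le => u.
      exact: measurable_large_sensitivity.
    rewrite mem_enum => uD.
    apply: (@large_sensitivity_le _ _ _ _ _ D X indep gauss _ (x0 k)) => //.
    - exact: multiaffine_cramer_det.
    - exact: offD.
    - by lra.
  apply: (le_trans (measureU2 P _ _)).
  - by apply: bigsetU_measurable => q _; exact: measurable_large_sensitivity.
  - apply: bigsetU_measurable => k _; apply: bigsetU_measurable => u _.
    exact: measurable_large_sensitivity.
  apply: (le_trans (leeD P1 P2)); rewrite -EFinD lee_fin.
  have s1 : 1 <= s by exact: le_trans nS.
  (* There are |S| + n (|S| + n) <= 3 n |S| events. *)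
  have count : s * p + n%:R * ((s + n%:R) * p) <= 3 * (n%:R * s) * p.
    have : s <= n%:R * s by nra.
    have : n%:R * n%:R <= n%:R * s by nra.
    by move=> ? ?; nra.
  apply: (le_trans count).
  (* From t_j >= 10/3 follows t_j - 1 >= (7/10) t_j. *)
  have p_le : p <= 8 / 13 * (10 / 7) / t j.
    rewrite /p ler_pdivrMr; last by lra.
    rewrite mulrAC ler_pdivlMr; last by lra.
    lra.
  (* The constant is 3 (8/13) (10/7) (3/10); the factor n |S| cancels against [t j]. *)
  have -> : 72 / 91 * (3 / 2)^-1 ^+ j = 3 * (n%:R * s) * (8 / 13 * (10 / 7) / t j).
    rewrite /t exprVn; field.
    have rj : (3 / 2 : R) ^+ j != 0 by rewrite expf_neq0 //; lra.
    have s_neq0 : s != 0 by lra.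
    by rewrite rj s_neq0 gt_eqF.
  by apply: ler_wpM2l => //; nra.
have condE j w : ~ E j w ->
    (cond_linear (\matrix_(i < n, j < n) a i j w) (\col_(i < n) b i w) <=
       (10 * n%:R * s ^+ 2 * (3 / 2) ^+ j)%:E)%E.
  move=> /not_orP[nE1 nE2].
  have sens p : p \in S ->
      `|X (inl p) w * slope (@sys_det R n) (sample w) (inl p)| < t j * `|sys_det (sample w)|.
    move=> pS; rewrite ltNge; apply/negP => bad; apply: nE1.
    by rewrite -bigcup_seq; exists p => //=; rewrite mem_enum.
  have sensk k u : u \in D ->
      `|X u w * slope (cramer_det k) (sample w) u| < t j * `|cramer_det k (sample w)|.
    move=> uD; rewrite ltNge; apply/negP => bad; apply: nE2.
    rewrite -bigcup_seq; exists k; first by rewrite /= mem_enum.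
    by rewrite -bigcup_seq; exists u => //=; rewrite mem_enum.
  (* Outside E_j the inequalities are strict, so neither det A nor any g_k vanishes. *)
  have nz (c : R) : 0 < t j * `|c| -> c != 0.
    by apply: contraTneq => ->; rewrite normr0 mulr0 ltxx.
  (* An entry of S, existing since 0 < n <= |S|, supplies the strict inequality for det A. *)
  have [p pS] : exists p, p \in S.
    by apply/card_gt0P; exact: leq_trans leS.
  have [-> ->] : \matrix_(i, j) a i j w = sys_mx (sample w) /\
      \col_i b i w = sys_col (sample w).
    by split; apply/matrixP => i l; rewrite !mxE.
  have K_le : (2 * s + n%:R) * t j <= 10 * n%:R * s ^+ 2 * (3 / 2) ^+ j.
    rewrite (_ : 10 * n%:R * s ^+ 2 * (3 / 2) ^+ j = (2 * s + s) * t j).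
      by apply: ler_wpM2r; [have := t_ge j; lra|rewrite lerD2l].
    by rewrite /t; field.
  apply: (@le_trans _ _ ((2 * s + n%:R) * t j)%:E); last by rewrite lee_fin.
  apply: cond_linear_le.
  - by move=> i l ilS; rewrite /sample /= offS.
  - by apply: nz; apply: le_lt_trans (sens p pS).
  - move=> k; apply: nz; apply: le_lt_trans (sensk k (inr k) _) => //.
    by rewrite inE.
  - by have := t_ge j; lra.
  - by move=> q qS; apply/ltW/sens.
  - by move=> k u uD; apply/ltW/sensk.
have s1 : 1 <= s by exact: le_trans nS.
have K1 : 1 <= 10 * n%:R * s ^+ 2 by have : 1 <= n%:R * s ^+ 2; nra.
have q0 : 0 <= 72 / 91 :> R by lra.
have rho1 : 1 < 3 / 2 :> R by lra.
apply: (le_trans (integral_log_plus_le beta_gt1 K1 rho1 q0 mE PE condE)).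
have lb : 0 < ln beta by exact: ln_gt0.
rewrite lee_fin; apply: lerD.
  rewrite /log_base !lnM ?posrE ?mulr_gt0 ?exprn_gt0 //; lra.
rewrite mulrAC ler_pM2r ?invr_gt0 //.
(* The tail bounds 72/91 (2/3)^j sum to 216/91; times ln(3/2) <= 21/50 this is at most 4536/4550 <
   1. *)
have := ln_three_halves_le R.
have -> : 72 / 91 / (1 - (3 / 2)^-1) = 216 / 91 :> R by field.
lra.
Qed.
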